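(* Let $\mathscr{C}$ be a finitely complete category endowed with a Grothendieck topology $J$, let $C$ be an object of $\mathscr{C}$ and let $p:1\to C$ be a point of $C$. Let $\mathscr{N}_p(C)$ be the collection of all cover-neighborhoods of $p$, i.e. of all sieves on $C$ that contain a $\mathfrak{G}$-neighborhood of $p$. Then the pair $(C,\mathscr{N}_p(C))$ is a filtered object; that is: (F1) if $S\in\mathscr{N}_p(C)$ and $R$ is a sieve on $C$ with $S\subseteq R$, then $R\in\mathscr{N}_p(C)$; (F2) every finite intersection of sieves of $\mathscr{N}_p(C)$ belongs to $\mathscr{N}_p(C)$; (F3) the empty sieve is not in $\mathscr{N}_p(C)$.
   Context: A sieve on an object $C$ is a family $S$ of morphisms of $\mathscr{C}$ with codomain $C$ such that $f\in S$ implies $f\circ g\in S$ whenever the composite is defined; sieves on $C$ are ordered by inclusion, and unions and intersections of sieves are sieves. $J(C)$ denotes the collection of covering sieves on $C$ for the Grothendieck topology $J$. A point of $C$ is a morphism $p:1\to C$, where $1$ is a terminal object of $\mathscr{C}$. A $\mathfrak{G}$-neighborhood of a point $p$ of $C$ is a sieve $V\in J(C)$ for which there exist a morphism $\phi:D\to C$ in $V$ and a point $q:1\to D$ with $\phi\circ q=p$. A cover-neighborhood of $p$ is a sieve on $C$ that contains (as a subset) some $\mathfrak{G}$-neighborhood of $p$. A pair $(C,\mathcal{F})$ with $\mathcal{F}$ a collection of sieves on $C$ is called a filtered object if $\mathcal{F}$ satisfies (F1), (F2), (F3). *)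

(* Defs.v *)
From Stdlib Require Import List FinFun.

Set Implicit Arguments.
Unset Strict Implicit.

Record Category := {
  Obj :> Type;
  Hom : Obj -> Obj -> Type;
  id : forall A, Hom A A;
  comp : forall A B D, Hom B D -> Hom A B -> Hom A D;
  comp_id_l : forall A B (f : Hom A B), comp (id B) f = f;
  comp_id_r : forall A B (f : Hom A B), comp f (id A) = f;
  comp_assoc : forall A B D E (h : Hom D E) (g : Hom B D) (f : Hom A B),
    comp h (comp g f) = comp (comp h g) f
}.

Arguments Hom {c} A B.
Arguments id {c} A.
Arguments comp {c A B D} g f : rename.

Declare Scope cat_scope.
Delimit Scope cat_scope with cat.
Notation "g ∘ f" := (comp g f) (at level 40, left associativity) : cat_scope.
Open Scope cat_scope.

Record Functor (I C : Category) := {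
  fobj :> I -> C;
  fmap : forall i j, Hom i j -> Hom (fobj i) (fobj j);
  fmap_id : forall i, fmap (id i) = id (fobj i);
  fmap_comp : forall i j k (g : Hom j k) (f : Hom i j),
    fmap (g ∘ f) = fmap g ∘ fmap f
}.

Definition is_terminal (C : Category) (T : C) : Prop :=
  forall A : C, exists! f : Hom A T, True.

Record Cone (I C : Category) (F : Functor I C) := {
  apex : C;
  leg : forall i, Hom apex (F i);
  leg_commutes : forall i j (u : Hom i j), fmap F u ∘ leg i = leg j
}.

Definition is_limit (I C : Category) (F : Functor I C) (L : Cone F) : Prop :=
  forall K : Cone F,
    exists! u : Hom (apex K) (apex L), forall i, leg L i ∘ u = leg K i.

Definition finite_category (I : Category) : Prop :=
  Finite I /\ forall i j : I, Finite (Hom i j).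

Definition finitely_complete (C : Category) : Prop :=
  forall (I : Category) (F : Functor I C),
    finite_category I -> exists L : Cone F, is_limit L.

Record Sieve (C : Category) (A : C) := {
  mem : forall D : C, Hom D A -> Prop;
  mem_comp : forall (D E : C) (f : Hom D A) (g : Hom E D),
    mem f -> mem (f ∘ g)
}.

Definition sieve_le (C : Category) (A : C) (S R : Sieve A) : Prop :=
  forall (D : C) (f : Hom D A), mem S f -> mem R f.

Definition max_sieve (C : Category) (A : C) : Sieve A :=
  {| mem := fun (D : C) (_ : Hom D A) => True;
     mem_comp := fun _ _ _ _ h => h |}.

Definition empty_sieve (C : Category) (A : C) : Sieve A :=
  {| mem := fun (D : C) (_ : Hom D A) => False;
     mem_comp := fun _ _ _ _ h => h |}.

(* Intersection of a finite family; the empty family gives the maximal sieve. *)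
Definition sieve_inter (C : Category) (A : C) (l : list (Sieve A)) : Sieve A.
Proof.
  refine {| mem := fun D f => forall S, In S l -> mem S f |}.
  intros D E f g Hf S HS. apply mem_comp. exact (Hf S HS).
Defined.

Definition sieve_pullback (C : Category) (A B : C) (h : Hom B A)
  (S : Sieve A) : Sieve B.
Proof.
  refine {| mem := fun D g => mem S (h ∘ g) |}.
  intros D E f g Hf. rewrite comp_assoc. apply mem_comp. exact Hf.
Defined.

Record GrothendieckTopology (C : Category) := {
  covers :> forall A : C, Sieve A -> Prop;
  covers_max : forall A : C, covers (max_sieve A);
  covers_stable : forall (A B : C) (h : Hom B A) (S : Sieve A),
    covers S -> covers (sieve_pullback h S);
  covers_trans : forall (A : C) (S R : Sieve A),
    covers S ->
    (forall (B : C) (h : Hom B A), mem S h -> covers (sieve_pullback h R)) ->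
    covers R
}.

(* In the next two definitions [one] is meant to be a terminal object, so that
   [p : Hom one A] is a point of [A]. *)
Definition G_neighborhood (C : Category) (J : GrothendieckTopology C)
  (one A : C) (p : Hom one A) (V : Sieve A) : Prop :=
  J A V /\
  exists (D : C) (phi : Hom D A) (q : Hom one D), mem V phi /\ phi ∘ q = p.

Definition cover_neighborhood (C : Category) (J : GrothendieckTopology C)
  (one A : C) (p : Hom one A) (S : Sieve A) : Prop :=
  exists V : Sieve A, G_neighborhood J p V /\ sieve_le V S.

Record is_filtered_object (C : Category) (A : C) (F : Sieve A -> Prop) : Prop := {
  filtered_F1 : forall S R : Sieve A, F S -> sieve_le S R -> F R;
  filtered_F2 : forall l : list (Sieve A),
    (forall S, In S l -> F S) -> F (sieve_inter l);
  filtered_F3 : ~ F (empty_sieve A)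
}.

(* Main.v *)
(** A sieve is closed under precomposition, so a covering sieve [V] is a
    neighborhood of [p] exactly when [V] contains [p] itself, and the
    cover-neighborhoods of [p] are the covering sieves that contain [p]. Both
    conditions pass to larger sieves and to finite intersections, and the empty
    sieve does not contain [p]. *)
From Stdlib Require Import List.
From Stdlib Require Import FunctionalExtensionality PropExtensionality ProofIrrelevance.
Require Import Defs.

Lemma sieve_ext (C : Category) (A : C) (S R : Sieve A) :
  sieve_le S R -> sieve_le R S -> S = R.
Proof.
  destruct S as [mS cS], R as [mR cR]; unfold sieve_le; cbn; intros SR RS.
  assert (e : mS = mR).
  { extensionality D. extensionality f.
    apply propositional_extensionality; split; auto. }
  subst mR. f_equal. apply proof_irrelevance.
Qed.

(** Along any member of [S], the larger sieve [R] pulls back to the maximal sieve, so transitivity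
    applies. *)
Lemma covers_upward {C : Category} {J : GrothendieckTopology C} {A : C}
  {S R : Sieve A} : J A S -> sieve_le S R -> J A R.
Proof.
  intros JS SR. apply (covers_trans JS); intros B h hS.
  replace (sieve_pullback h R) with (max_sieve B); [apply covers_max |].
  apply sieve_ext; intros D g _; cbn; [| exact I].
  apply SR, mem_comp, hS.
Qed.

Lemma covers_sieve_inter (C : Category) (J : GrothendieckTopology C) (A : C)
  (l : list (Sieve A)) :
  (forall S, In S l -> J A S) -> J A (sieve_inter l).
Proof.
  induction l as [| S l IH]; intros Jl.
  - apply (covers_upward (covers_max J A)). intros D f _ S [].
  (* Along [h] in [S] the condition imposed by [S] is automatic, so only the intersection over the
     tail matters; its pullback covers by stability. *)
  - apply (covers_trans (Jl S (or_introl eq_refl))); intros B h hS.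
    apply (covers_upward (S := sieve_pullback h (sieve_inter l))).
    + apply covers_stable, IH. intros R Rl. apply Jl; right; exact Rl.
    + intros D g gl R [<- | Rl]; [apply mem_comp, hS | exact (gl R Rl)].
Qed.

Lemma cover_neighborhood_iff {C : Category} {J : GrothendieckTopology C}
  {one A : C} {p : Hom one A} {S : Sieve A} :
  cover_neighborhood J p S <-> J A S /\ mem S p.
Proof.
  split.
  - intros (V & (JV & D & phi & q & Vphi & <-) & VS). split.
    + exact (covers_upward JV VS).
    + apply VS, mem_comp, Vphi.
  (* [S] is its own neighborhood: [p] factors through the member [p] via the identity point of
     [one]. *)
  - intros [JS Sp]. exists S. split.
    + split; [exact JS |]. exists one, p, (id one).
      split; [exact Sp | apply comp_id_r].
    + intros D f Sf; exact Sf.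
Qed.

Theorem theorem4p3 (C : Category) (hC : finitely_complete C)
  (J : GrothendieckTopology C) (one : C) (hone : is_terminal one)
  (A : C) (p : Hom one A) :
  is_filtered_object (cover_neighborhood J p).
Proof.
  split.
  - intros S R (V & HV & VS) SR. exists V. split; [exact HV |].
    intros D f Vf; apply SR, VS, Vf.
  - intros l Hl.
    assert (Hl' : forall S, In S l -> J A S /\ mem S p)
      by (intros S Sl; apply cover_neighborhood_iff, Hl, Sl).
    apply cover_neighborhood_iff. split.
    + apply covers_sieve_inter. intros S Sl; apply Hl', Sl.
    + intros S Sl; apply Hl', Sl.
  (* The second half of [H], membership of [p] in the empty sieve, computes to [False]. *)
  - intros H. apply cover_neighborhood_iff in H. apply H.
Qed.
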